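(* Consider vertex-weighted online bipartite matching with stochastic rewards and patience under adversarial arrivals (defined in the context), and suppose we are given a $\kappa$-approximate black box for the star graph problem, for some $\kappa\in(0,1]$. Let the greedy algorithm be: when online vertex $v$ arrives, let $U_v\subseteq U$ be the set of currently unmatched offline vertices, run the black box on the star graph formed by $v$ and $U_v$, and execute the probing strategy it returns. Then for every instance $G$, $\mathsf{ALG}(G)\ge \tfrac{\kappa}{2}\,\mathsf{OPT}(G)$, where $\mathsf{ALG}(G)$ is the expected total weight matched by this algorithm (for every arrival order) and $\mathsf{OPT}(G)$ is the expected weight of an optimal offline algorithm.
   Context: Instance: bipartite graph with offline vertices $U$ and online vertices $V$; each $u\in U$ has weight $w_u\ge0$; each pair $(u,v)$ has a known probability $p_{u,v}\in[0,1]$ that the edge exists when probed (independently across edges). Each online vertex $v$ has a patience $\theta_v$, which is either a known deterministic positive integer or a random positive integer with known distribution (independent across vertices; if random, it is revealed only when exhausted). Probing an edge $(u,v)$ with $u$ unmatched: if it exists, $u$ and $v$ are matched irrevocably and weight $w_u$ is earned (probe-commit); each edge is probed at most once; an online vertex stops being probed once matched or once the number of its failed probes reaches $\theta_v$. Online vertices arrive one at a time in an adversarially chosen order; all probes of an online vertex must be made upon its arrival, before the next arrival. Star graph problem for $v$ and $U'\subseteq U$: the same probing process restricted to the single online vertex $v$ and offline vertices $U'$; let $\mathsf{OPT}(U',v)$ denote its optimal expected reward. A $\kappa$-approximate black box returns, for any such $(U',v)$, a probing strategy with expected reward at least $\kappa\,\mathsf{OPT}(U',v)$. $\mathsf{OPT}(G)$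 is the maximum expected matched weight of an adaptive offline probing algorithm that knows the whole graph in advance, may probe edges in any order, subject to the same probe-commit, one-probe-per-edge, matching and patience constraints. *)

(* Defs.v *)
From HB Require Import structures.
From mathcomp Require Import all_boot all_order all_algebra.
From mathcomp Require Import all_classical all_reals all_analysis.

Set Implicit Arguments.
Unset Strict Implicit.
Unset Printing Implicit Defensive.

Import Order.TTheory GRing.Theory Num.Theory.
Local Open Scope classical_set_scope.
Local Open Scope ring_scope.

(* [patience v] is the probability mass function of theta_v on the positive
   integers; a deterministic, known patience is a point mass. *)
Record instance (R : realType) (U V : finType) := Instance {
  weight : U -> R;
  prob : U * V -> R;
  patience : V -> nat -> R;
  weight_ge0 : forall u, 0 <= weight u;
  prob_itv : forall e, 0 <= prob e <= 1;
  patience_ge0 : forall v n, 0 <= patience v n;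
  patience_gt0 : forall v, patience v 0%N = 0;
  patience_sum1 : forall v, (\esum_(n in [set: nat]) (patience v n)%:E = 1)%E
}.

Section Probing.
Variables (R : realType) (U V : finType) (G : instance R U V).

(* The hidden randomness: which edges exist, and the patience of each online
   vertex. *)
Definition realization : Type := ({ffun U * V -> bool} * {ffun V -> nat})%type.

(* All edges and all patiences are independent. *)
Definition realization_pmf (omega : realization) : R :=
  (\prod_(e : U * V) (if omega.1 e then prob G e else 1 - prob G e)) *
  \prod_(v : V) patience G v (omega.2 v).

(* Only used for nonnegative F. *)
Definition expect (F : realization -> R) : \bar R :=
  \esum_(omega in [set: realization]) (realization_pmf omega * F omega)%:E.

(* What is observed when an edge (u, v) is probed.  [FailureLast] is a failed
   probe exhausting the patience of v: this is the only way in which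
   information about the patience is revealed. *)
Variant outcome := Success | Failure | FailureLast.

Definition is_success (o : outcome) : bool :=
  if o is Success then true else false.

Definition is_failure (o : outcome) : bool :=
  if o is Failure then true else false.

(* Probes made so far with their outcomes, most recent first. *)
Definition history : Type := seq ((U * V) * outcome).

Definition probed (h : history) : seq (U * V) := [seq x.1 | x <- h].

Definition matched_offline (h : history) : {set U} :=
  [set u | has (fun x => (x.1.1 == u) && is_success x.2) h].

Definition failed_probes (h : history) (v : V) : nat :=
  count (fun x => (x.1.2 == v) && ~~ is_success x.2) h.

(* v is matched or its patience is exhausted. *)
Definition stopped_online (h : history) (v : V) : bool :=
  has (fun x => (x.1.2 == v) && ~~ is_failure x.2) h.

Definition observe (omega : realization) (h : history) (e : U * V) : outcome :=
  if omega.1 e then Success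
  else if ((failed_probes h e.2).+1 < omega.2 e.2)%N then Failure
  else FailureLast.

(* After history h, the edge e may be probed by an algorithm restricted to the
   edges of E. *)
Definition may_probe (E : {set U * V}) (h : history) (e : U * V) : bool :=
  [&& e \in E, e \notin probed h, e.1 \notin matched_offline h
    & ~~ stopped_online h e.2].

(* An adaptive, possibly randomized, probing strategy: given the history, a
   distribution over the next action, which is either to stop ([None]) or to
   probe an edge. *)
Definition policy : Type := history -> option (U * V) -> R.

Definition policy_on (E : {set U * V}) (pi : policy) : Prop :=
  forall h : history,
    [/\ forall a, 0 <= pi h a,
        \sum_(a : option (U * V)) pi h a = 1
      & forall e, pi h (Some e) != 0 -> may_probe E h e].

(* Expectation, over the coins of [pi] only, of f(final history) when [pi] is
   run from h on the realization omega for at most n probes. *)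
Fixpoint run (n : nat) (pi : policy) (omega : realization)
    (f : history -> R) (h : history) : R :=
  if n is n'.+1 then
    pi h None * f h +
    \sum_(e : U * V)
      pi h (Some e) * run n' pi omega f ((e, observe omega h e) :: h)
  else f h.

(* As edges are probed at most once, #|U * V| probes never cut a run short. *)
Definition exec (pi : policy) (omega : realization) (f : history -> R) : R :=
  run #|{: U * V}| pi omega f [::].

Definition reward (h : history) : R :=
  \sum_(x <- h | is_success x.2) weight G x.1.1.

Definition value (pi : policy) : \bar R :=
  expect (fun omega => exec pi omega reward).

Definition opt_on (E : {set U * V}) : \bar R :=
  ereal_sup [set value pi | pi in [set pi | policy_on E pi]].

Definition OPT : \bar R := opt_on [set: U * V]%SET.

Definition star (U' : {set U}) (v : V) : {set U * V} :=
  [set e | (e.1 \in U') && (e.2 == v)].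

Definition star_OPT (U' : {set U}) (v : V) : \bar R := opt_on (star U' v).

Definition black_box (kappa : R) (B : {set U} -> V -> policy) : Prop :=
  forall (U' : {set U}) (v : V),
    policy_on (star U' v) (B U' v) /\
    (kappa%:E * star_OPT U' v <= value (B U' v))%E.

(* Greedy on the arrivals [vs], where U' is the set of offline vertices that
   are still unmatched; expectation over the coins of the strategies only.
   An arriving vertex has not been probed yet, so the strategy for its star
   starts from the empty history. *)
Fixpoint greedy_run (B : {set U} -> V -> policy) (omega : realization)
    (vs : seq V) (U' : {set U}) : R :=
  if vs is v :: vs' then
    exec (B U' v) omega (fun h =>
      reward h + greedy_run B omega vs' (U' :\: matched_offline h)%SET)
  else 0.

Definition ALG (B : {set U} -> V -> policy) (order : seq V) : \bar R :=
  expect (fun omega => greedy_run B omega order [set: U]%SET).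

End Probing.

(* Main.v *)
(* Idea.  For an offline policy pi let y_uv be the probability that it matches
   u to v.  For every set U' of offline vertices, sum_{u in U'} w_u y_uv is at
   most the optimum of the star problem (U', v), since pi in particular probes
   the edges of that star.  Hence, when v meets the set U_v of free vertices, greedy
   earns at least kappa sum_{u in U_v} w_u y_uv in expectation.  A term lost
   because u is no longer free is paid for by the weight w_u already earned by
   greedy, as sum_v y_uv <= 1.  So OPT is at most twice ALG / kappa.

   Letting a star strategy simulate pi would require hidden memory, which
   policies lack.  Instead, the star problem is solved by dynamic programming:
   its value bounds the reward of pi inside the star, and it is attained by
   probing along a fixed list of offline vertices. *)
Require Import Defs.
From mathcomp Require Import all_boot all_order all_algebra.
From mathcomp Require Import all_classical all_reals all_analysis.
From mathcomp Require Import ring.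

Import Order.TTheory GRing.Theory Num.Theory.
Import numFieldNormedType.Exports.
Local Open Scope ring_scope.

Set Implicit Arguments.
Unset Strict Implicit.
Unset Printing Implicit Defensive.

(** * Finite product laws *)

Section ProductLaw.
Variables (R : realType) (I T : finType) (mu : I -> T -> R).
Hypothesis mu_ge0 : forall i t, 0 <= mu i t.
Hypothesis mu_sum1 : forall i, \sum_t mu i t = 1.

Definition prodE (F : {ffun I -> T} -> R) : R :=
  \sum_(x : {ffun I -> T}) (\prod_i mu i (x i)) * F x.

Lemma eq_prodE F G : F =1 G -> prodE F = prodE G.
Proof. by move=> FG; apply: eq_bigr => x _; rewrite FG. Qed.

Lemma prodE_cst c : prodE (fun=> c) = c.
Proof.
rewrite /prodE -big_distrl /= -bigA_distr_bigA /= big1 ?mul1r // => i _.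
Qed.

Lemma le_prodE F G : (forall x, F x <= G x) -> prodE F <= prodE G.
Proof.
by move=> FG; apply: ler_sum => x _; apply: ler_wpM2l => //; apply: prodr_ge0.
Qed.

Lemma prodED F G : prodE (fun x => F x + G x) = prodE F + prodE G.
Proof. by rewrite -big_split; apply: eq_bigr => x _; rewrite mulrDr. Qed.

Lemma prodEZ c F : prodE (fun x => c * F x) = c * prodE F.
Proof. by rewrite /prodE big_distrr; apply: eq_bigr => x _; rewrite mulrCA. Qed.

(* Independence: exchanging the coordinates outside S of two independent samples
   preserves their joint law. *)
Lemma prodE_split (S : pred I) (F : {ffun I -> T} -> {ffun I -> T} -> R) :
  (forall x x' y y' : {ffun I -> T},
    {in S, x =1 x'} -> {in [predC S], y =1 y'} -> F x y = F x' y') ->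
  prodE (fun x => F x x) = prodE (fun x => prodE (F x)).
Proof.
move=> FS.
pose mix (x y : {ffun I -> T}) := [ffun i => if S i then x i else y i].
pose sw (p : {ffun I -> T} * {ffun I -> T}) := (mix p.1 p.2, mix p.2 p.1).
have swK : involutive sw.
  by case=> x y; congr pair; apply/ffunP => i; rewrite !ffunE /=; case: (S i).
have -> : prodE (fun x => prodE (F x)) =
    \sum_(p : {ffun I -> T} * {ffun I -> T})
    (\prod_i mu i (p.1 i)) * (\prod_i mu i (p.2 i)) * F p.1 p.2.
  rewrite -(pair_bigA _ (fun x y : {ffun I -> T} =>
    (\prod_i mu i (x i)) * (\prod_i mu i (y i)) * F x y)) /=.
  apply: eq_bigr => x _; rewrite /prodE big_distrr /=.
  by apply: eq_bigr => y _; rewrite mulrA.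
(* After the swap the first argument agrees with [p.1] on [S] and the second agrees with [p.1] off
   [S], so [FS] turns both into [p.1]; [p.2] then integrates to 1. *)
rewrite (reindex_inj (inv_inj swK)) /=.
under eq_bigr => p _.
  rewrite -big_split /= (FS _ p.1 _ p.1); last 2 first.
  - by move=> i Si; rewrite ffunE ifT.
  - by move=> i; rewrite inE ffunE => /negbTE Si; rewrite ifF.
  under eq_bigr do rewrite !ffunE.
  rewrite (_ : \prod_i _ =
      (\prod_i mu i (p.1 i)) * (\prod_i mu i (p.2 i))); last first.
    rewrite -big_split; apply: eq_bigr => i _.
    by case: (S i) => //; rewrite mulrC.
  over.
rewrite -(pair_bigA _ (fun x y : {ffun I -> T} =>
    (\prod_i mu i (x i)) * (\prod_i mu i (y i)) * F x x)) /=.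
apply: eq_bigr => x _; rewrite -[LHS]prodE_cst /prodE.
by apply: eq_bigr => y _; rewrite mulrCA mulrA.
Qed.

End ProductLaw.

Lemma exchange_prodE (R : realType) (I I' T T' : finType) (mu : I -> T -> R)
    (mu' : I' -> T' -> R) F :
  prodE mu (fun x => prodE mu' (F x)) = prodE mu' (fun y => prodE mu (F^~ y)).
Proof.
rewrite /prodE; under eq_bigr do rewrite big_distrr /=.
rewrite exchange_big; apply: eq_bigr => y _; rewrite big_distrr /=.
by apply: eq_bigr => x _; rewrite mulrCA.
Qed.

(** On a box of side [n] the sum factors by distributivity. Every finite set lies in such a box,
    which gives one inequality; letting [n] tend to infinity gives the other. *)
Lemma esum_prod (R : realType) (V : finType) (g : V -> nat -> R) (s : V -> R) :
  (forall v n, 0 <= g v n) ->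
  (forall v, \esum_(n in [set: nat]) (g v n)%:E = (s v)%:E) ->
  \esum_(x in [set: {ffun V -> nat}]) (\prod_v g v (x v))%:E
    = (\prod_v s v)%:E.
Proof.
move=> g0 gs.
have psum v n : \sum_(i < n) g v i <= s v.
  rewrite -lee_fin -gs -nneseries_esumT //; last by move=> k; rewrite lee_fin.
  rewrite -(big_mkord xpredT) -sumEFin.
  by apply: nneseries_lim_ge => k _ _; rewrite lee_fin.
have s0 v : 0 <= s v by rewrite (le_trans _ (psum v 0)) // big_ord0.
pose em n (f : {ffun V -> 'I_n}) : {ffun V -> nat} := [ffun v => f v : nat].
have box n : \prod_v \sum_(i < n) g v i =
    \sum_(f : {ffun V -> 'I_n}) \prod_v g v (em n f v).
  rewrite bigA_distr_bigA; apply: eq_bigr => f _.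
  by apply: eq_bigr => v _; rewrite ffunE.
have em_inj n : injective (em n).
  move=> f f' /ffunP ff'; apply/ffunP => v; apply: val_inj.
  by have := ff' v; rewrite !ffunE.
have boxE n : (\prod_v \sum_(i < n) g v i)%:E =
    \esum_(x in range (em n)) (\prod_v g v (x v))%:E.
  rewrite esum_image; last by move=> x y _ _; apply: em_inj.
  rewrite (esum_fset (@finite_finset _ _)); last first.
    by move=> f _; rewrite lee_fin prodr_ge0.
  rewrite box -sumEFin fsbig_seq ?index_enum_uniq //.
  congr (\big[_/_]_(x \in _) _); apply/seteqP; split => // f _ /=.
  by rewrite mem_index_enum.
apply/eqP; rewrite eq_le; apply/andP; split.
  apply: ge_ereal_sup => _ [X [finX _] <-].
  have [n Xn] : exists n, (X `<=` range (em n))%classic.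
    (* The largest coordinate of a point of [X]; box coordinates are strictly below the side, hence
       [n.+1]. *)
    pose n := \max_(x <- finmap.enum_fset (fset_set X)) \max_v (x v).
    exists n.+1 => x Xx; have lt v : (x v < n.+1)%N.
      rewrite ltnS; apply: (leq_trans (leq_bigmax v)).
      by rewrite /n (bigD1_seq x) /= ?leq_maxl // in_fset_set // inE.
    exists [ffun v => Ordinal (lt v)] => //.
    by apply/ffunP => v; rewrite !ffunE.
  apply: (@le_trans _ _ (\prod_v \sum_(i < n) g v i)%:E); last first.
    by rewrite lee_fin; apply: ler_prod => v _; rewrite psum sumr_ge0.
  by rewrite boxE; apply: ereal_sup_ubound; exists X.
have lim : ((fun n => (\prod_v \sum_(i < n) g v i)%:E) @ \oo -->
    (\prod_v s v)%:E)%classic.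
  apply/cvg_EFin; first by near=> n.
  have := @cvg_big R V *%R 1 xpredT (@mul_continuous R) nat \oo%classic
    (index_enum V) (fun v n => \sum_(i < n) g v i) s _.
  apply => v _.
  have : ((fun n => (\sum_(i < n) g v i)%:E) @ \oo --> (s v)%:E)%classic.
    rewrite -gs -nneseries_esumT => [|k]; last by rewrite lee_fin.
    under eq_fun do rewrite -sumEFin -(big_mkord xpredT (fun i => (g v i)%:E)).
    by apply: is_cvg_nneseries => k _ _; rewrite lee_fin.
  by move/fine_cvgP => [].
rewrite -(cvg_lim _ lim) //; apply: lime_le.
  by apply/cvg_ex; exists (\prod_v s v)%:E.
near=> n; rewrite boxE; apply: ge_ereal_sup => _ [X [finX _] <-].
by apply: ereal_sup_ubound; exists X.
Unshelve. all: by end_near.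
Qed.

(** * Reducing expectations to a finite sample space *)

Lemma esumZ (R : realType) (T : choiceType) (f : T -> R) (c s : R) :
  0 <= c -> (forall x, 0 <= f x) ->
  \esum_(x in [set: T]) (f x)%:E = s%:E ->
  \esum_(x in [set: T]) (c * f x)%:E = (c * s)%:E.
Proof.
have le (g : T -> R) (d : R) : 0 <= d -> (forall x, 0 <= g x) ->
    (\esum_(x in [set: T]) (d * g x)%:E <=
     d%:E * \esum_(x in [set: T]) (g x)%:E)%E.
  move=> d0 g0; apply: ge_ereal_sup => _ [X [finX _] <-].
  rewrite (eq_fsbigr (fun x => d%:E * (g x)%:E)%E) //.
  rewrite -ge0_mule_fsumr => [|x]; last by rewrite lee_fin.
  by apply: lee_wpmul2l; rewrite ?lee_fin //; apply: ereal_sup_ubound; exists X.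
rewrite le_eqVlt => /predU1P[<- f0 _|c0 f0 fs].
  by rewrite mul0r esum1 // => x _; rewrite mul0r.
have c0' := ltW c0.
apply/eqP; rewrite eq_le EFinM -fs le //=.
(* The reverse inequality is the same one, applied to [c * f] with the factor [c^-1]. *)
have := le (fun x => c * f x) c^-1.
rewrite invr_ge0 (eq_esum (b := fun x => (f x)%:E)); last first.
  by move=> x _; rewrite mulKf ?gt_eqF.
move=> /(_ c0' (fun x => mulr_ge0 c0' (f0 x))) /(lee_wpmul2l (x := c%:E)).
by rewrite lee_fin muleA -EFinM mulfV ?gt_eqF // mul1e; apply.
Qed.

Section Expectation.
Variables (R : realType) (U V : finType) (G : instance R U V) (N : nat).

Definition edge_mass (e : U * V) (b : bool) : R :=
  if b then prob G e else 1 - prob G e.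

(* A run makes at most #|U * V| probes, so for large N it cannot distinguish a
   patience above N from N. *)
Definition clipped_mass (v : V) (j : 'I_N.+1) : R :=
  fine (\esum_(n in [set: nat]) (patience G v n * (minn n N == j)%:R)%:E).

Definition of_sample (a : {ffun U * V -> bool}) (t : {ffun V -> 'I_N.+1}) :
  realization U V := (a, [ffun v => t v : nat]).

Definition Ex (F : realization U V -> R) : R :=
  prodE edge_mass (fun a => prodE clipped_mass (fun t => F (of_sample a t))).

Definition clip (omega : realization U V) : realization U V :=
  (omega.1, [ffun v => minn (omega.2 v) N]).

Lemma edge_mass_ge0 e b : 0 <= edge_mass e b.
Proof. by case/andP: (prob_itv G e) => ? ?; case: b; rewrite ?subr_ge0. Qed.

Lemma edge_mass_sum1 e : \sum_b edge_mass e b = 1.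
Proof. by rewrite big_bool /= addrC subrK. Qed.

Lemma clipped_mass_ge0 v (j : 'I_N.+1) : 0 <= clipped_mass v j.
Proof.
apply/fine_ge0/esum_ge0 => n _; rewrite lee_fin mulr_ge0 //.
exact: patience_ge0.
Qed.

Lemma clipped_massE v (j : 'I_N.+1) :
  \esum_(n in [set: nat]) (patience G v n * (minn n N == j)%:R)%:E =
  (clipped_mass v j)%:E.
Proof.
rewrite fineK // ge0_fin_numE; last first.
  by apply/esum_ge0 => n _; rewrite lee_fin mulr_ge0 // patience_ge0.
apply: (@le_lt_trans _ _ 1%E); last exact: ltry.
rewrite -(patience_sum1 G v); apply: le_esum => n _.
by rewrite lee_fin ler_piMr ?patience_ge0 // lern1 leq_b1.
Qed.

Lemma clipped_mass_sum1 v : \sum_(j < N.+1) clipped_mass v j = 1.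
Proof.
apply: EFin_inj; rewrite -sumEFin.
under eq_bigr do rewrite -clipped_massE.
rewrite -esum_sum => [|n j _ _]; last first.
  by rewrite lee_fin mulr_ge0 // patience_ge0.
rewrite -[RHS](patience_sum1 G v); apply: eq_esum => n _.
rewrite sumEFin -big_distrr /= (bigD1 (inord (minn n N))) //= big1.
  by rewrite inordK ?ltnS ?geq_minr // eqxx addr0 mulr1.
by move=> j; rewrite -val_eqE /= inordK ?ltnS ?geq_minr // eq_sym => /negbTE ->.
Qed.

(** [F] only sees truncated patiences, so the infinite sum can be grouped by the truncation [t] of
    the patience vector; each group has a product mass by [esum_prod]. *)
Lemma expectE F : (forall omega, 0 <= F omega) ->
  (forall omega, F (clip omega) = F omega) -> expect G F = (Ex F)%:E.
Proof.
move=> F0 FC; rewrite /expect.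
have pmf_ge0 omega : 0 <= realization_pmf G omega.
  by rewrite mulr_ge0 // prodr_ge0 // => [e|v] _;
    rewrite ?edge_mass_ge0 // patience_ge0.
transitivity (\esum_(a in [set: {ffun U * V -> bool}])
    \esum_(x in [set: {ffun V -> nat}])
      (realization_pmf G (a, x) * F (a, x))%:E).
  rewrite esum_esum => [|a x _ _]; last by rewrite lee_fin mulr_ge0.
  rewrite (_ : _ `*`` _ = setT)%classic; last by apply/seteqP.
  by apply: eq_esum => -[].
rewrite (esum_fset (@finite_finset _ _)) => [|a _]; last first.
  by apply: esum_ge0 => x _; rewrite lee_fin mulr_ge0.
rewrite (_ : [set: {ffun U * V -> bool}] =
    [set` index_enum {ffun U * V -> bool}])%classic; last first.
  by apply/seteqP; split => // a _ /=; rewrite mem_index_enum.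
rewrite -fsbig_seq ?index_enum_uniq // -sumEFin.
apply: eq_bigr => a _.
pose w (x : {ffun V -> nat}) := \prod_v patience G v (x v).
have w_ge0 x : 0 <= w x by rewrite prodr_ge0 // => v _; apply: patience_ge0.
rewrite (eq_esum (b := fun x => (\prod_e edge_mass e (a e) *
    (w x * F (a, x)))%:E)); last by move=> x _; rewrite mulrA.
apply: (esumZ (f := fun x => w x * F (a, x))) => [|x|].
- by apply: prodr_ge0 => e _; apply: edge_mass_ge0.
- exact: mulr_ge0.
pose g (t : {ffun V -> 'I_N.+1}) v n : R :=
  patience G v n * (minn n N == t v)%:R.
have g_ge0 t v n : 0 <= g t v n by rewrite mulr_ge0 // patience_ge0.
(* Exactly one [t] is the truncation of [x], and the indicator of this factors over the online
   vertices. *)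
rewrite (eq_esum (b := fun x : {ffun V -> nat} => \sum_(t : {ffun V -> 'I_N.+1})
    (F (of_sample a t) * \prod_v g t v (x v))%:E)); last first.
  move=> x _; rewrite sumEFin; congr _%:E.
  have lt v : (minn (x v) N < N.+1)%N by rewrite ltnS geq_minr.
  pose t0 : {ffun V -> 'I_N.+1} := [ffun v => Ordinal (lt v)].
  rewrite (bigD1 t0) //= [X in _ + X]big1 => [|t tt0]; last first.
    have [v tv] : exists v, t v != t0 v.
      apply/existsP; apply: contraR tt0 => /existsPn tt0.
      by apply/eqP/ffunP => v; apply/eqP; rewrite -[_ == _]negbK.
    rewrite (bigD1 v) //= /g; move: tv; rewrite ffunE -val_eqE /= eq_sym.
    by move=> /negbTE ->; rewrite mulr0 mul0r mulr0.
  rewrite addr0 mulrC -FC; congr (F _ * _).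
    by congr pair; apply/ffunP => v; rewrite !ffunE.
  by apply: eq_bigr => v _; rewrite /g ffunE eqxx mulr1.
rewrite esum_sum => [|x t _ _]; last by rewrite lee_fin mulr_ge0 // prodr_ge0.
rewrite -sumEFin; apply: eq_bigr => t _; rewrite mulrC.
apply: esumZ => // [x|]; first exact: prodr_ge0.
by apply: esum_prod => // v; rewrite /g clipped_massE.
Qed.

Lemma eq_Ex F F' : F =1 F' -> Ex F = Ex F'.
Proof. by move=> FF'; apply: eq_prodE => a; apply: eq_prodE => t. Qed.

Lemma Ex_cst c : Ex (fun=> c) = c.
Proof.
rewrite -[RHS](prodE_cst edge_mass_sum1); apply: eq_prodE => a.
exact: prodE_cst clipped_mass_sum1 c.
Qed.

Lemma le_Ex F F' : (forall omega, F omega <= F' omega) -> Ex F <= Ex F'.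
Proof.
move=> FF'; apply: le_prodE => [e b|a]; first exact: edge_mass_ge0.
by apply: le_prodE => [v j|t //]; apply: clipped_mass_ge0.
Qed.

Lemma Ex_ge0 F : (forall omega, 0 <= F omega) -> 0 <= Ex F.
Proof. by move=> F0; rewrite -[0]Ex_cst; apply: le_Ex. Qed.

Lemma ExD F F' : Ex (fun omega => F omega + F' omega) = Ex F + Ex F'.
Proof. by rewrite -prodED; apply: eq_prodE => a; rewrite -prodED. Qed.

Lemma ExZ c F : Ex (fun omega => c * F omega) = c * Ex F.
Proof. by rewrite -prodEZ; apply: eq_prodE => a; rewrite -prodEZ. Qed.

Lemma Ex_sum (I : Type) (r : seq I) (P : pred I) F :
  Ex (fun omega => \sum_(i <- r | P i) F i omega) =
  \sum_(i <- r | P i) Ex (F i).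
Proof.
elim: r => [|i r IH].
  by rewrite big_nil -[RHS]Ex_cst; apply: eq_Ex => omega; rewrite big_nil.
rewrite big_cons -IH; case: ifP => Pi; rewrite -?ExD; apply: eq_Ex => omega;
  by rewrite big_cons Pi.
Qed.

Definition agree (S : pred (U * V)) (T : pred V) (x y : realization U V) :=
  {in S, x.1 =1 y.1} /\ {in T, x.2 =1 y.2}.

(** Independence, from [prodE_split] applied first to the patiences with the edges fixed, then to
    the edges. *)
Lemma Ex_split (S : pred (U * V)) (T : pred V)
    (F : realization U V -> realization U V -> R) :
  (forall x x' y y', agree S T x x' -> agree [predC S] [predC T] y y' ->
    F x y = F x' y') ->
  Ex (fun omega => F omega omega) = Ex (fun omega => Ex (F omega)).
Proof.
move=> FST; rewrite /Ex.
transitivity (prodE edge_mass (fun a => prodE clipped_mass (fun t =>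
    prodE clipped_mass (fun t' => F (of_sample a t) (of_sample a t'))))).
  apply: eq_prodE => a.
  apply: (prodE_split clipped_mass_sum1 (S := T)
    (F := fun t t' => F (of_sample a t) (of_sample a t'))) => x x' y y' xx' yy'.
  by apply: FST; split=> //= v vT; rewrite !ffunE ?xx' ?yy'.
rewrite (prodE_split edge_mass_sum1 (S := S) (F := fun a a' =>
    prodE clipped_mass (fun t => prodE clipped_mass (fun t' =>
      F (of_sample a t) (of_sample a' t'))))).
  apply: eq_prodE => a; rewrite exchange_prodE.
  by apply: eq_prodE => t.
move=> x x' y y' xx' yy'; apply: eq_prodE => t; apply: eq_prodE => t'.
by apply: FST; split=> //= v vT; rewrite ?xx' ?yy'.
Qed.

Lemma ExM (S : pred (U * V)) (T : pred V) (X Y : realization U V -> R) :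
  (forall x x', agree S T x x' -> X x = X x') ->
  (forall y y', agree [predC S] [predC T] y y' -> Y y = Y y') ->
  Ex (fun omega => X omega * Y omega) = Ex X * Ex Y.
Proof.
move=> XS YS; rewrite (Ex_split (S := S) (T := T) (F := fun x y => X x * Y y)).
  by rewrite mulrC -ExZ; apply: eq_Ex => x; rewrite ExZ mulrC.
by move=> x x' y y' /XS -> /YS ->.
Qed.

End Expectation.

Arguments eq_Ex {R U V G N F F'}.
Arguments le_Ex {R U V G N F F'}.
Arguments ExM {R U V G N} S T {X Y}.
Arguments Ex_split {R U V G N} S T {F}.

(** * Runs of policies *)

Section Runs.
Variables (R : realType) (U V : finType).
Implicit Types (pi : policy R U V) (omega : realization U V).
Implicit Types (h : history U V) (E : {set U * V}).

(** The histories that a policy on [E] can reach from [[::]]. A policy is defined on all histories,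
    but facts such as the distinctness of probed edges hold only on these. *)
Fixpoint legal E h : bool :=
  if h is x :: h' then may_probe E h' x.1 && legal E h' else true.

Lemma legal_uniq E h : legal E h -> uniq (probed h).
Proof. by elim: h => //= x h IH /andP[/and4P[_ -> _ _] /IH]. Qed.

Section Invariant.
Variables (E : {set U * V}) (pi : policy R U V) (P : history U V -> Prop).
Hypothesis pi_on : policy_on E pi.
Hypothesis P_step : forall h e o, P h -> may_probe E h e -> P ((e, o) :: h).

(** An edge chosen with nonzero probability is admissible, so the invariant [P] propagates and only
    histories satisfying it need be compared. *)
Lemma eq_run omega omega' f f' n h :
  (forall h e, P h -> may_probe E h e ->
    observe omega h e = observe omega' h e) ->
  (forall h, P h -> f h = f' h) -> P h ->
  run n pi omega f h = run n pi omega' f' h.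
Proof.
move=> obs ff'; elim: n h => [|n IH] h Ph /=; first exact: ff'.
congr (_ * _ + _); first exact: ff'.
apply: eq_bigr => e _; have [->|pe] := eqVneq (pi h (Some e)) 0.
  by rewrite !mul0r.
have [_ _ /(_ e pe) he] := pi_on h.
by rewrite (obs h e) // IH //; apply: P_step.
Qed.

Lemma le_run omega f f' n h :
  (forall h, P h -> f h <= f' h) -> P h ->
  run n pi omega f h <= run n pi omega f' h.
Proof.
move=> ff'; elim: n h => [|n IH] h Ph /=; first exact: ff'.
have [pi0 _ pi_may] := pi_on h.
apply: lerD; first by apply: ler_wpM2l => //; apply: ff'.
apply: ler_sum => e _; have [->|pe] := eqVneq (pi h (Some e)) 0.
  by rewrite !mul0r.
by apply: ler_wpM2l => //; apply/IH/P_step => //; apply: pi_may.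
Qed.

Lemma run_cst omega f c n h :
  (forall h, P h -> f h = c) -> P h -> run n pi omega f h = c.
Proof.
move=> fc; elim: n h => [|n IH] h Ph /=; first exact: fc.
have [_ pi1 pi_may] := pi_on h.
rewrite fc // -[RHS]mul1r -pi1 (bigD1 None) //= mulrDl; congr (_ + _).
rewrite [in RHS](reindex_omap Some id) => [|[]//] /=.
rewrite big_distrl /=; apply: eq_big => [e|e _]; first by rewrite eqxx.
have [->|pe] := eqVneq (pi h (Some e)) 0; first by rewrite !mul0r.
by congr (_ * _); apply/IH/P_step => //; apply: pi_may.
Qed.

End Invariant.

Lemma run_linear pi omega a f f' n h :
  run n pi omega (fun h => a * f h + f' h) h =
  a * run n pi omega f h + run n pi omega f' h.
Proof.
elim: n h => [//|n IH] h /=.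
under eq_bigr do rewrite IH mulrDr mulrCA.
by rewrite big_split /= -big_distrr /= !mulrDr mulrCA addrACA.
Qed.

Lemma run_sum pi omega (I : Type) (r : seq I) (P : pred I) (a : I -> R) f n h :
  run n pi omega (fun h => \sum_(i <- r | P i) a i * f i h) h =
  \sum_(i <- r | P i) a i * run n pi omega (f i) h.
Proof.
elim: n h => [//|n IH] h /=.
under [X in _ + X = _]eq_bigr do rewrite IH.
rewrite big_distrr; under [X in _ + X = _]eq_bigr do rewrite big_distrr.
rewrite exchange_big /= -big_split; apply: eq_bigr => i _ /=.
rewrite mulrDr mulrCA; congr (_ + _).
by rewrite big_distrr; apply: eq_bigr => e _; rewrite mulrCA.
Qed.

Lemma legal_step E h e o :
  legal E h -> may_probe E h e -> legal E ((e, o) :: h).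
Proof. by move=> /= -> ->. Qed.

(** The probed edges together with [e] are distinct, so one more than the number of failures is at
    most the number of edges, hence below the truncation level. *)
Lemma observe_clip omega E h e : legal E h -> may_probe E h e ->
  observe (clip #|{: U * V}|.+1 omega) h e = observe omega h e.
Proof.
move=> hE eE; rewrite /observe /= ffunE ltn_min.
suff -> : ((failed_probes h e.2).+1 < #|{: U * V}|.+1)%N by rewrite andbT.
rewrite ltnS (leq_trans (n := (size h).+1)) ?ltnS ?count_size //.
have /legal_uniq/card_uniqP := legal_step Success hE eE.
by rewrite /= size_map => <-; apply: max_card.
Qed.

Lemma exec_ge0 pi omega E f : policy_on E pi -> (forall h, 0 <= f h) ->
  0 <= exec pi omega f.
Proof.
move=> piE f0; rewrite -(run_cst (P := xpredT) (f := fun=> 0) (c := 0)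
  piE _ omega #|{: U * V}| _ (h := [::])) //.
by apply: (le_run (P := xpredT) piE).
Qed.

Lemma exec_clip pi omega E f f' : policy_on E pi ->
  (forall h, f h = f' h) ->
  exec pi (clip #|{: U * V}|.+1 omega) f = exec pi omega f'.
Proof.
move=> piE ff'; apply: (eq_run (P := legal E) piE) => // [h e o|h e].
  exact: legal_step.
exact: observe_clip.
Qed.

Lemma matched_offline_cons h e o : matched_offline ((e, o) :: h) =
  if is_success o then e.1 |: matched_offline h else matched_offline h.
Proof.
apply/finset.setP => u; rewrite /matched_offline.
by case: o; rewrite /= !inE ?andbT ?andbF //= eq_sym.
Qed.

End Runs.

(** * Rewards and match counts *)

Section Reward.
Variables (R : realType) (U V : finType) (G : instance R U V).
Implicit Types (h : history U V) (E : {set U * V}).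

Definition successes h e : R :=
  (count (fun x => (x.1 == e) && is_success x.2) h)%:R.

Lemma successes_cons h e o e' : successes ((e, o) :: h) e' =
  ((e == e') && is_success o)%:R + successes h e'.
Proof. by rewrite /successes /= natrD. Qed.

Lemma reward_cons h e o : reward G ((e, o) :: h) =
  (if is_success o then weight G e.1 else 0) + reward G h.
Proof. by rewrite /reward big_cons /=; case: o; rewrite ?add0r. Qed.

Lemma rewardE h :
  reward G h = \sum_u weight G u * \sum_v successes h (u, v).
Proof.
elim: h => [|[e o] h IH].
  by rewrite /reward big_nil big1 // => u _; rewrite big1 ?mulr0.
rewrite reward_cons IH; under [RHS]eq_bigr do under eq_bigr do
  rewrite successes_cons.
under [RHS]eq_bigr do rewrite big_split mulrDr /=.
rewrite big_split /=; congr (_ + _); case: e => u0 v0 /=.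
rewrite (bigD1 u0) //= (bigD1 v0) //= eqxx /= !big1 => [|u|v]; last 2 first.
- rewrite eq_sym => /negbTE uu0; rewrite big1 ?mulr0 // => v _.
  by rewrite xpair_eqE uu0.
- by rewrite eq_sym => /negbTE vv0; rewrite xpair_eqE vv0 andbF.
by rewrite !addr0; case: o; rewrite ?mulr1 ?mulr0.
Qed.

(** A matched offline vertex is never probed again, so [u] has at most one success. This is the
    source of the bound 1 on the total match probability of [u]. *)
Lemma legal_successes E h u : legal E h ->
  \sum_v successes h (u, v) = (u \in matched_offline h)%:R.
Proof.
elim: h => [_|[[u0 v0] o] h IH /= /andP[/and4P[_ _ /= u0h _] hE]].
  by rewrite inE big1.
under eq_bigr do rewrite successes_cons; rewrite big_split /= IH //.
rewrite matched_offline_cons; case: o; rewrite /= ?in_setU1; last 2 first.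
- by rewrite big1 ?add0r // => v _; rewrite andbF.
- by rewrite big1 ?add0r // => v _; rewrite andbF.
rewrite (bigD1 v0) //= xpair_eqE eqxx !andbT big1 ?addr0 => [|v]; last first.
  by rewrite eq_sym => /negbTE vv0; rewrite xpair_eqE vv0 andbF.
by rewrite (eq_sym u); case: eqP => [<-|_]; rewrite ?(negbTE u0h) ?addr0 ?add0r.
Qed.

Lemma legal_reward E h : legal E h ->
  reward G h = \sum_(u in matched_offline h) weight G u.
Proof.
move=> hE; rewrite rewardE [RHS]big_mkcond; apply: eq_bigr => u _.
by rewrite (legal_successes u hE); case: ifP; rewrite ?mulr1 ?mulr0.
Qed.

Lemma reward_ge0 h : 0 <= reward G h.
Proof. by apply: sumr_ge0 => x _; apply: weight_ge0. Qed.

End Reward.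

(** * The star problem *)

Section Star.
Variables (R : realType) (U V : finType) (G : instance R U V) (v : V).
Implicit Types (h : history U V) (omega : realization U V) (A : {set U}).

Local Notation "'E[' F ]" := (Ex G #|{: U * V}|.+1 F).

(* After k failed probes of v, the last of which did not exhaust its patience,
   another one is possible.  For k = 0 this holds for every patience, 0
   included, in accordance with [observe]. *)
Definition allowed k omega := (k == 0%N) || (k < omega.2 v)%N.
Definition succ_prob u : R := E[fun omega => (omega.1 (u, v))%:R].
Definition tail k : R := E[fun omega => (allowed k omega)%:R].

(* The Bellman recursion, multiplied through by the probability [tail k] of
   reaching k failures on account of the patience: this avoids dividing by
   it. *)
Fixpoint star_val n k A : R :=
  if n is n'.+1 then
    \big[Num.max/0]_(u in A)
      (tail k * succ_prob u * weight G u +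
       (1 - succ_prob u) * star_val n' k.+1 (A :\ u)%SET)
  else 0.

(** The value of probing along [L] until [v] stops, scaled by [tail k] in the same way as
    [star_val]. *)
Fixpoint list_val k (L : seq U) : R :=
  if L is u :: L' then
    tail k * succ_prob u * weight G u + (1 - succ_prob u) * list_val k.+1 L'
  else 0.

Lemma succ_prob_ge0 u : 0 <= succ_prob u.
Proof. by apply: Ex_ge0. Qed.

Lemma succ_prob_le1 u : succ_prob u <= 1.
Proof.
rewrite -[1](Ex_cst G #|{: U * V}|.+1); apply: le_Ex => omega.
by rewrite lern1 leq_b1.
Qed.

Lemma tail_anti k k' : (k <= k')%N -> tail k' <= tail k.
Proof.
move=> kk'; apply: le_Ex => omega.
have : allowed k' omega -> allowed k omega.
  rewrite /allowed; case: k kk' => //= k; case: k' => //= k' kk'.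
  exact: leq_ltn_trans.
by case: (allowed k' omega) => // ->.
Qed.

Lemma star_val_ge0 n k A : 0 <= star_val n k A.
Proof. by case: n => //= n; apply: bigmax_ge_id. Qed.

(** Fewer past failures make survival likelier, and a further probe can be declined. This covers
    probes that bring nothing to the star. *)
Lemma star_val_mono n k k' A : (k <= k')%N ->
  star_val n k' A <= star_val n.+1 k A.
Proof.
elim: n k k' A => [|n IH] k k' A kk'; first exact: star_val_ge0.
apply: bigmax_le => [|u uA]; first exact: star_val_ge0.
apply: le_trans (le_bigmax_cond _ _ uA); apply: lerD.
  rewrite -!mulrA ler_wpM2r ?tail_anti // mulr_ge0 ?succ_prob_ge0 //.
  exact: weight_ge0.
by rewrite ler_wpM2l ?subr_ge0 ?succ_prob_le1 //; apply: IH.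
Qed.

(** A star run continues only after a failure, so the maximizers of the recursion, read along
    successive failures, form one fixed list; the default 0 of the maximum corresponds to
    stopping. *)
Lemma star_val_list n k A : exists L,
  [/\ uniq L, {subset L <= A}, (size L <= n)%N & list_val k L = star_val n k A].
Proof.
elim: n k A => [|n IH] k A /=; first by exists [::].
elim/big_ind: _ => [|x y Lx Ly|u uA]; first by exists [::].
  by case: leP.
have [L [Lu LA Ln Lval]] := IH k.+1 (A :\ u)%SET.
exists (u :: L); split => //=; last by rewrite Lval.
  by rewrite Lu andbT; apply/negP => /LA; rewrite !inE eqxx.
by move=> x; rewrite inE => /predU1P[-> //|/LA]; rewrite !inE => /andP[].
Qed.

(* When all probes of v in h are failures, [survives h] is the event that the
   coordinates of v are compatible with h; [all_fail h] ignores the patience. *)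
Definition all_fail h omega :=
  all (fun x => (x.1.2 == v) ==> ~~ omega.1 x.1) h.
Definition survives h omega :=
  allowed (failed_probes h v) omega && all_fail h omega.

Definition off_v (Z : realization U V -> R) :=
  forall x y, agree (fun e => e.2 != v) (fun v' => v' != v) x y -> Z x = Z y.

Lemma all_fail_agree (S : pred (U * V)) T h x y :
  agree S T x y -> {subset probed h <= S} -> all_fail h x = all_fail h y.
Proof.
move=> [xy _] hS; rewrite /all_fail; elim: h hS => //= z h IH hS.
rewrite (xy z.1) ?IH // => [e eh|]; apply: hS; rewrite inE ?eqxx //.
by rewrite eh orbT.
Qed.

(** Only [allowed] reads the patience of [v], and it reads nothing else, so it splits off by
    independence. *)
Lemma Ex_survives Z h : off_v Z ->
  E[fun omega => Z omega * (survives h omega)%:R] =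
  tail (failed_probes h v) * E[fun omega => Z omega * (all_fail h omega)%:R].
Proof.
move=> Zv; rewrite -(ExM pred0 (pred1 v)) => [|x y [_ xy]|x y xy].
- by apply: eq_Ex => omega; rewrite -mulnb natrM mulrCA.
- by rewrite /allowed xy // inE.
- rewrite (Zv x y); first by rewrite (all_fail_agree (h := h) xy).
  by split=> e ?; apply: xy.1 || apply: xy.2.
Qed.

(** An unprobed edge of [v] is independent of what has been observed. The parameter [c] is free so
    as to cover both [survives] and, at [c = 0] where [allowed] is always true, [all_fail]. *)
Lemma Ex_edge Z h u c : off_v Z -> (u, v) \notin probed h ->
  E[fun omega => (omega.1 (u, v))%:R * (Z omega *
     (allowed c omega && all_fail h omega)%:R)] =
  succ_prob u * E[fun omega => Z omega *
     (allowed c omega && all_fail h omega)%:R].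
Proof.
move=> Zv uh; rewrite -(ExM (pred1 (u, v)) pred0) // => [x y [xy _]|x y xy].
  by rewrite xy // inE.
rewrite (Zv x y); last first.
  split=> e ev; last exact: xy.2.
  by apply: xy.1; rewrite inE; apply: contraNneq ev => ->.
rewrite (all_fail_agree (h := h) xy) ?/allowed ?xy.2 //.
by move=> e eh; rewrite inE; apply: contraNneq uh => <-.
Qed.

(** Writing the outcome through indicators turns conditioning on it into polynomial identities. *)
Lemma observe_split (g : outcome -> R) omega h e :
  let b := (omega.1 e)%:R in
  let a := ((failed_probes h e.2).+1 < omega.2 e.2)%N%:R in
  g (observe omega h e) =
  b * g Success + (1 - b) * a * g Failure + (1 - b) * (1 - a) * g FailureLast.
Proof.
rewrite /= /observe; case: (omega.1 e); case: ltnP => _ /=; ring.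
Qed.

(** * Upper bound on what any policy earns in a star *)

Section Upper.
Variables (E : {set U * V}) (pi : policy R U V) (U' : {set U}).
Hypothesis pi_on : policy_on E pi.

Definition star_reward h : R :=
  \sum_(u in U') weight G u * successes R h (u, v).

(** Vertices already matched to another online vertex are kept: the star problem still offers
    them. *)
Definition remaining h : {set U} := [set u in U' | (u, v) \notin probed h].

Lemma star_reward_cons h e o : star_reward ((e, o) :: h) =
  (if [&& e.2 == v, is_success o & e.1 \in U'] then weight G e.1 else 0) +
  star_reward h.
Proof.
rewrite /star_reward; under eq_bigr do rewrite successes_cons mulrDr.
rewrite big_split /=; congr (_ + _); case: e => u v' /=.
have [->|vv'] := eqVneq v' v; last first.
  by rewrite big1 // => i _; rewrite xpair_eqE (negbTE vv') andbF mulr0.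
case: o => /=; rewrite ?andbF; last 2 first.
- by rewrite big1 // => i _; rewrite andbF mulr0.
- by rewrite big1 // => i _; rewrite andbF mulr0.
under eq_bigr => i _ do rewrite xpair_eqE eqxx !andbT eq_sym mulr_natr mulrb.
rewrite -big_mkcondr /=; case: ifP => uU'.
  by rewrite (big_pred1 u) // => i; rewrite /= andbC; case: eqP => // ->.
by rewrite big1 // => i /andP[iU' /eqP ui]; rewrite ui uU' in iU'.
Qed.

Lemma run_stopped n omega h : stopped_online h v ->
  run n pi omega star_reward h = star_reward h.
Proof.
move=> hv; apply: (run_cst (P := fun h' =>
  stopped_online h' v /\ star_reward h' = star_reward h) pi_on) => [|h' []|] //.
move=> h' e o [h'v h'r] /and4P[_ _ _ he]; split; first by rewrite /= h'v orbT.
rewrite star_reward_cons h'r ifF ?add0r //.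
by apply: contraNF he => /andP[/eqP ->].
Qed.

(* Z stands for the information that the probes of h outside v give on the
   other coordinates. *)
Lemma run_le_star_val n h (Z : realization U V -> R) :
  legal E h -> ~~ stopped_online h v ->
  (forall omega, 0 <= Z omega) -> off_v Z ->
  E[fun omega => Z omega * (survives h omega)%:R *
      run n pi omega star_reward h] <=
  E[fun omega => Z omega * (survives h omega)%:R] * star_reward h +
  E[fun omega => Z omega * (all_fail h omega)%:R] *
    star_val n (failed_probes h v) (remaining h).
Proof.
elim: n h Z => [|n IH] h Z hE hv Z0 Zv.
  rewrite mulr0 addr0 mulrC -ExZ le_eqVlt; apply/orP; left.
  by apply/eqP/eq_Ex => omega; rewrite mulrC.
set k := failed_probes h v; set B := (X in _ <= X).
have ZJ0 : 0 <= E[fun omega => Z omega * (all_fail h omega)%:R].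
  by apply: Ex_ge0 => omega; apply: mulr_ge0.
have [pi0 pi1 pi_may] := pi_on h.
(* [B] is the average of itself over the next action, and stopping earns only its first summand, so
   each single probe may be bounded separately. *)
suff step e : may_probe E h e -> E[fun omega => Z omega *
    (survives h omega)%:R *
    run n pi omega star_reward ((e, observe omega h e) :: h)] <= B.
  rewrite (_ : Ex _ _ _ = pi h None *
      (E[fun omega => Z omega * (survives h omega)%:R] * star_reward h) +
      \sum_e pi h (Some e) * E[fun omega => Z omega * (survives h omega)%:R *
        run n pi omega star_reward ((e, observe omega h e) :: h)]); last first.
    under [in RHS]eq_bigr do rewrite -ExZ.
    rewrite [_ * star_reward h]mulrC mulrA -ExZ -Ex_sum -ExD.
    apply: eq_Ex => omega /=.
    rewrite mulrDr [X in _ + X = _]mulr_sumr; congr (_ + _).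
      by rewrite mulrC.
    by apply: eq_bigr => e _; rewrite mulrCA.
  have -> : B = pi h None * B + \sum_e pi h (Some e) * B.
    rewrite -big_distrl -mulrDl /= -[LHS]mul1r -pi1 (bigD1 None) //=.
    rewrite (reindex_omap Some id) => [|[]//] /=.
    by congr ((_ + _) * _); apply: eq_bigl => e; rewrite eqxx.
  apply: lerD.
    by rewrite ler_wpM2l // /B lerDl mulr_ge0 // star_val_ge0.
  apply: ler_sum => e _; have [->|pe] := eqVneq (pi h (Some e)) 0.
    by rewrite !mul0r.
  by rewrite ler_wpM2l // step // pi_may.
move=> eE; have hoE o : legal E ((e, o) :: h) by rewrite legal_step.
rewrite (eq_Ex (F' := fun omega =>
  let b := (omega.1 e)%:R in
  let a := ((failed_probes h e.2).+1 < omega.2 e.2)%N%:R in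
  Z omega * b * (survives h omega)%:R *
    run n pi omega star_reward ((e, Success) :: h) +
  (Z omega * ((1 - b) * a) * (survives h omega)%:R *
    run n pi omega star_reward ((e, Failure) :: h) +
  Z omega * ((1 - b) * (1 - a)) * (survives h omega)%:R *
    run n pi omega star_reward ((e, FailureLast) :: h)))); last first.
  move=> omega; rewrite (observe_split (fun o =>
    run n pi omega star_reward ((e, o) :: h))) /=; ring.
rewrite !ExD /=.
(* A probe outside [v] leaves the star as it is: the indicator [c] of its outcome is absorbed into
   [Z], and [star_val_mono] makes up for the step spent. *)
have [ev|ev] := eqVneq e.2 v; last first.
  have other (c : realization U V -> R) o : (forall omega, 0 <= c omega) ->
      (forall x y : realization U V,
        x.1 e = y.1 e -> x.2 e.2 = y.2 e.2 -> c x = c y) ->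
      E[fun omega => Z omega * c omega * (survives h omega)%:R *
          run n pi omega star_reward ((e, o) :: h)] <=
      E[fun omega => Z omega * c omega * (survives h omega)%:R] * star_reward h
      + E[fun omega => Z omega * c omega * (all_fail h omega)%:R] *
        star_val n.+1 k (remaining h).
    move=> c0 ce.
    have := IH ((e, o) :: h) (fun omega => Z omega * c omega) (hoE o).
    rewrite /= (negbTE ev) /= => /(_ hv); rewrite /survives /= (negbTE ev) /=.
    rewrite add0n star_reward_cons (negbTE ev) add0r => le.
    have -> : remaining h = remaining ((e, o) :: h).
      apply/finset.setP => u; rewrite !inE; congr (_ && ~~ _).
      by case: eqP => //= ue; rewrite -ue eqxx in ev.
    apply: (le_trans (le _ _)) => [omega|x y xy|]; first exact: mulr_ge0.
      by rewrite (Zv _ _ xy) (ce x y) ?xy.1 ?xy.2.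
    rewrite lerD2l ler_wpM2l ?star_val_mono //.
    by apply: Ex_ge0 => omega; rewrite !mulr_ge0.
  apply: le_trans
    (lerD (other _ _ _ _) (lerD (other _ _ _ _) (other _ _ _ _))) _.
  - by [].
  - by move=> x y ->.
  - by move=> omega; rewrite mulr_ge0 // subr_ge0 lern1 leq_b1.
  - by move=> x y -> ->.
  - by move=> omega; rewrite mulr_ge0 // subr_ge0 lern1 leq_b1.
  - by move=> x y -> ->.
  pose b omega : R := (omega.1 e)%:R.
  pose a omega : R := ((failed_probes h e.2).+1 < omega.2 e.2)%N%:R.
  (* The factors of the three outcomes sum to 1, so the three bounds add up to [B]. *)
  have split3 (F : realization U V -> R) :
      E[fun omega => Z omega * F omega] =
      E[fun omega => Z omega * b omega * F omega] +
      (E[fun omega => Z omega * ((1 - b omega) * a omega) * F omega] +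
       E[fun omega => Z omega * ((1 - b omega) * (1 - a omega)) * F omega]).
    by rewrite -!ExD; apply: eq_Ex => omega; ring.
  rewrite /B (split3 (fun omega => (survives h omega)%:R)).
  rewrite (split3 (fun omega => (all_fail h omega)%:R)) /a /b.
  by rewrite le_eqVlt; apply/orP; left; apply/eqP; ring.
case: e eE hoE ev => u v' /= eE hoE ev; subst v'.
have [_ uh _ _] := and4P eE.
pose b omega : R := (omega.1 (u, v))%:R.
pose a omega : R := (k.+1 < omega.2 v)%N%:R.
set x := E[fun omega => Z omega * (survives h omega)%:R] in B *.
set y := E[fun omega => Z omega * (all_fail h omega)%:R] in ZJ0 B *.
pose t := E[fun omega =>
  Z omega * ((1 - b omega) * (1 - a omega)) * (survives h omega)%:R].
pose fail := ((u, v), Failure) :: h.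
have survF omega : (survives fail omega)%:R =
    (1 - b omega) * a omega * (survives h omega)%:R.
  rewrite /survives /= eqxx /= add1n -/k /a /b /allowed /=.
  case: (omega.1 _); rewrite /= ?andbF ?subrr ?mul0r // subr0 mul1r.
  case: ltnP => [lt|]; rewrite ?mul0r // mul1r.
  by rewrite (ltnW lt) orbT.
have Eq : E[fun omega => b omega * (Z omega * (survives h omega)%:R)] =
    succ_prob u * x by apply: Ex_edge.
(* The mass [x] splits into success, a failure after which [v] goes on, and the mass [t] of a
   failure exhausting the patience. *)
have xE : x = succ_prob u * x +
    (E[fun omega => Z omega * (survives fail omega)%:R] + t).
  by rewrite -Eq -!ExD; apply: eq_Ex => omega; rewrite survF; ring.
have yE : E[fun omega => Z omega * (all_fail fail omega)%:R] =
    (1 - succ_prob u) * y.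
  have := @Ex_edge Z h u 0 Zv uh; rewrite /allowed /= -/y => yq.
  rewrite mulrBl mul1r -yq; apply/eqP.
  rewrite eq_sym subr_eq -ExD; apply/eqP/eq_Ex => omega /=.
  by rewrite eqxx /=; case: (omega.1 _) => /=; rewrite ?mul1r ?mul0r; ring.
(* This converts the success mass into a multiple of [y], the factor of [star_val] in [B]; it is why
   the recursion carries [tail k]. *)
have xy : x = tail k * y by apply: Ex_survives.
(* The Bellman step: for [u] in [U'] the left side is one term of the maximum; otherwise nothing is
   gained and a failure is spent, which [star_val_mono] covers. *)
have leD : tail k * succ_prob u * (if u \in U' then weight G u else 0) +
    (1 - succ_prob u) * star_val n k.+1 (remaining fail) <=
    star_val n.+1 k (remaining h).
  case: ifP => uU'; last first.
    rewrite mulr0 add0r (_ : remaining fail = remaining h).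
      apply: le_trans (star_val_mono _ _ (leqnSn k)).
      by rewrite ler_piMl ?star_val_ge0 // gerBl succ_prob_ge0.
    apply/finset.setP => u'; rewrite !inE xpair_eqE eqxx andbT.
    by case: eqP => //= ->; rewrite uU'.
  have ur : u \in remaining h by rewrite inE uU'.
  rewrite (_ : remaining fail = remaining h :\ u)%SET.
    exact: le_bigmax_cond ur.
  apply/finset.setP => u'; rewrite !inE xpair_eqE eqxx andbT negb_or.
  by rewrite andbCA.
rewrite (eq_Ex (F' := fun omega => star_reward (((u, v), Success) :: h) *
    (b omega * (Z omega * (survives h omega)%:R)))); last first.
  move=> omega; rewrite run_stopped /= ?eqxx // /b; ring.
rewrite [X in _ + (_ + X)](eq_Ex (F' := fun omega => star_reward h *
    (Z omega * ((1 - b omega) * (1 - a omega)) *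
     (survives h omega)%:R))); last first.
  move=> omega; rewrite run_stopped /= ?eqxx // star_reward_cons andbF add0r.
  by rewrite mulrC.
rewrite [X in _ + (X + _)](eq_Ex (F' := fun omega => Z omega *
    (survives fail omega)%:R * run n pi omega star_reward fail)); last first.
  by move=> omega; rewrite survF !mulrA.
have leF := IH fail Z (hoE Failure).
rewrite (_ : failed_probes fail v = k.+1) in leF; last by rewrite /= eqxx add1n.
rewrite (_ : star_reward fail = star_reward h) in leF; last first.
  by rewrite star_reward_cons /= andbF add0r.
rewrite yE {1}/fail /= andbF in leF; have {leF} := leF hv Z0 Zv => leF.
rewrite !ExZ Eq -/t star_reward_cons eqxx /= /B.
apply: (le_trans (lerD (lexx _) (lerD leF (lexx _)))).
rewrite [leLHS](_ : _ = x * star_reward h + y * (tail k * succ_prob u *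
    (if u \in U' then weight G u else 0) +
    (1 - succ_prob u) * star_val n k.+1 (remaining fail))).
  by rewrite lerD2l ler_wpM2l.
set z := Ex _ _ _ in xE *.
have -> : z = x - succ_prob u * x - t by rewrite {1}xE; ring.
by rewrite xy; ring.
Qed.

End Upper.

End Star.

(** * The Bellman value is attained by probing along a list *)

Section StarOptimum.
Variables (R : realType) (U V : finType) (G : instance R U V) (v : V).
Implicit Types (h : history U V) (omega : realization U V).

Local Notation "'E[' F ]" := (Ex G #|{: U * V}|.+1 F).

Lemma exec_le_star_val E pi (U' : {set U}) : policy_on E pi ->
  E[fun omega => exec pi omega (star_reward G v U')] <=
  star_val G v #|{: U * V}| 0 U'.
Proof.
move=> piE.
have := run_le_star_val G (v := v) (h := [::]) (Z := fun=> 1) U' piE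
  #|{: U * V}| isT isT (fun=> ler01) (fun _ _ _ => erefl).
rewrite /survives /= (_ : star_reward _ _ _ _ = 0); last first.
  by rewrite /star_reward big1 // => u _; rewrite mulr0.
rewrite mulr0 add0r (eq_Ex (F' := fun omega => exec pi omega
  (star_reward G v U'))); last by move=> omega; rewrite !mul1r.
rewrite [X in _ <= X * _](eq_Ex (F' := fun=> 1)); last first.
  by move=> omega; rewrite mulr1.
rewrite Ex_cst mul1r (_ : remaining _ _ _ = U') //.
by apply/finset.setP => u; rewrite !inE andbT.
Qed.

Section ListPolicy.
Variables (U' : {set U}) (L : seq U).

(** While the run goes on every probe has failed, so the length of the history is the position in
    [L]. The test keeps the policy admissible on unreachable histories too. *)
Definition list_target h : option (U * V) :=
  if drop (size h) L is u :: _ then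
    if may_probe (star U' v) h (u, v) then Some (u, v) else None
  else None.

Definition list_policy : policy R U V := fun h a => (a == list_target h)%:R.

Lemma list_policy_on : policy_on (star U' v) list_policy.
Proof.
move=> h; split=> [a||e]; first exact: ler0n.
- rewrite (bigD1 (list_target h)) //= /list_policy eqxx big1 ?addr0 //.
  by move=> a /negbTE ->.
- rewrite /list_policy pnatr_eq0 eqb0 negbK /list_target => /eqP.
  by case: (drop _ _) => // u _; case: ifP => // may [->].
Qed.

Lemma run_list n omega f h : run n.+1 list_policy omega f h =
  if list_target h is Some e then
    run n list_policy omega f ((e, observe omega h e) :: h)
  else f h.
Proof.
rewrite /= /list_policy; case: (list_target h) => [e|]; last first.
  by rewrite eqxx mul1r big1 ?addr0 // => e _; rewrite mul0r.
rewrite mul0r add0r (bigD1 e) //= eqxx mul1r big1 ?addr0 // => e' e'e.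
by rewrite (inj_eq Some_inj) (negbTE e'e) mul0r.
Qed.

Lemma run_list_stopped n omega f h : stopped_online h v ->
  run n list_policy omega f h = f h.
Proof.
case: n => // n hv; rewrite run_list /list_target; case: drop => // u _.
by rewrite /may_probe hv !andbF.
Qed.

Lemma reward_failures h :
  all (fun x => is_failure x.2 && (x.1.2 == v)) h -> reward G h = 0.
Proof.
elim: h => [_|[e o] h IH /= /andP[/andP[fail_o _] /IH hr]].
  by rewrite /reward big_nil.
by rewrite reward_cons hr addr0; case: o fail_o.
Qed.

(** The induction of [run_le_star_val] with [Z = 1] and with equalities, since the only continuing
    history is that of the failures along [L]. *)
Lemma run_list_val n h L' :
  drop (size h) L = L' -> uniq L' -> {subset L' <= U'} -> (size L' <= n)%N ->
  all (fun x => is_failure x.2 && (x.1.2 == v)) h ->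
  (forall u, u \in L' -> (u, v) \notin probed h) ->
  E[fun omega => (survives v h omega)%:R *
     run n list_policy omega (reward G) h] =
  E[fun omega => (all_fail v h omega)%:R] * list_val G v (failed_probes h v) L'.
Proof.
elim: L' n h => [|u L' IH] n h hL /=.
  move=> _ _ _ hf _; rewrite mulr0 -[RHS](Ex_cst G #|{: U * V}|.+1).
  apply: eq_Ex => omega; suff -> : run n list_policy omega (reward G) h = 0.
    by rewrite mulr0.
  have r0 := reward_failures hf.
  by case: n => [//|n]; rewrite run_list /list_target hL.
case: n => // n /andP[uL' uniqL'] LU; rewrite ltnS => Ln hf Lh.
set k := failed_probes h v.
have uU : u \in U' by rewrite LU ?inE ?eqxx.
have uh : (u, v) \notin probed h by rewrite Lh ?inE ?eqxx.
have hv : ~~ stopped_online h v.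
  rewrite -all_predC; apply: sub_all hf => x /=.
  by case: x.2; rewrite ?andbF.
have hu : u \notin matched_offline h.
  rewrite inE -all_predC; apply: sub_all hf => x /=.
  by case: x.2; rewrite ?andbF.
have target : list_target h = Some (u, v).
  rewrite /list_target hL ifT //; apply/and4P; split=> //.
  by rewrite inE /= uU eqxx.
have r0 := reward_failures hf.
pose fail := ((u, v), Failure) :: h.
have kF : failed_probes fail v = k.+1 by rewrite /= eqxx add1n.
(* Success earns [weight G u] and ends the run, exhausted patience earns nothing, and only [Failure]
   continues. The factor [1] is the [Z] of [Ex_edge]. *)
rewrite (eq_Ex (F' := fun omega =>
  weight G u * ((omega.1 (u, v))%:R * (1 * (survives v h omega)%:R)) +
  (survives v fail omega)%:R *
    run n list_policy omega (reward G) fail)); last first.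
  move=> omega; rewrite run_list target (observe_split (fun o =>
    run n list_policy omega (reward G) ((u, v, o) :: h))).
  rewrite [run _ _ _ _ (_ :: _)]run_list_stopped /= ?eqxx //.
  rewrite [run _ _ _ _ ((_, FailureLast) :: _)]run_list_stopped /= ?eqxx //.
  rewrite !reward_cons /= r0.
  rewrite /survives kF /allowed /= eqxx -/k -/fail.
  case: (omega.1 _); rewrite /= ?andbF ?mulr0n; first by ring.
  case: (ltnP k.+1) => [lt|_] /=; rewrite ?mulr0n; last by ring.
  by rewrite (ltnW lt) orbT /=; ring.
have edge : E[fun omega =>
      (omega.1 (u, v))%:R * (1 * (survives v h omega)%:R)] =
    succ_prob G v u * E[fun omega => 1 * (survives v h omega)%:R].
  exact: (Ex_edge G (Z := fun=> 1)).
rewrite ExD ExZ edge (Ex_survives G (Z := fun=> 1)) //.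
rewrite IH //=; first last.
- move=> u' u'L'; rewrite inE negb_or Lh ?inE ?u'L' ?orbT // andbT.
  by rewrite xpair_eqE eqxx andbT; apply: contraNneq uL' => <-.
- by rewrite eqxx.
- by move=> u' u'L'; rewrite LU // inE u'L' orbT.
- by rewrite -add1n -drop_drop hL drop1.
rewrite eqxx add1n -/k.
set y := Ex _ _ (fun omega => 1 * _).
have -> : E[fun omega => (all_fail v h omega)%:R] = y.
  by apply: eq_Ex => omega; rewrite mul1r.
have yq := @Ex_edge _ _ _ G v (fun=> 1) h u 0 (fun _ _ _ => erefl) uh.
rewrite /allowed /= -/y in yq.
rewrite (_ : E[_] = (1 - succ_prob G v u) * y); first by ring.
rewrite mulrBl mul1r -yq; apply/eqP; rewrite eq_sym subr_eq -ExD.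
apply/eqP/eq_Ex => omega; case: (omega.1 _) => /=; ring.
Qed.

End ListPolicy.

Lemma star_val_le_star_OPT (U' : {set U}) :
  ((star_val G v #|{: U * V}| 0 U')%:E <= star_OPT G U' v)%E.
Proof.
have [L [Lu LU Ln <-]] := star_val_list G v #|{: U * V}| 0 U'.
apply: ereal_sup_ubound; exists (list_policy U' L).
  exact: list_policy_on.
rewrite /value (@expectE _ _ _ _ #|{: U * V}|.+1) => [|omega|omega].
- congr _%:E.
  have := @run_list_val U' L #|{: U * V}| [::] L _ Lu LU Ln isT _.
  rewrite drop0 => /(_ erefl (fun _ _ => isT)).
  rewrite (eq_Ex (F' := fun omega => exec (list_policy U' L) omega (reward G)));
    last by move=> omega; rewrite mul1r.
  by move=> ->; rewrite Ex_cst mul1r.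
- by apply: (exec_ge0 _ (@list_policy_on U' L)) => h; apply: reward_ge0.
- exact: (exec_clip _ (@list_policy_on U' L)).
Qed.

End StarOptimum.

(** * The greedy algorithm *)

Section Greedy.
Variables (R : realType) (U V : finType) (G : instance R U V).
Variables (kappa : R) (B : {set U} -> V -> policy R U V).
Hypotheses (kappa_gt0 : 0 < kappa) (kappa_le1 : kappa <= 1).
Hypothesis B_approx : black_box G kappa B.
Implicit Types (h : history U V) (omega : realization U V).

Local Notation "'E[' F ]" := (Ex G #|{: U * V}|.+1 F).

Let B_on U' v : policy_on (star U' v) (B U' v).
Proof. by have [] := B_approx U' v. Qed.

Lemma value_Ex E (pi : policy R U V) : policy_on E pi ->
  value G pi = (E[fun omega => exec pi omega (reward G)])%:E.
Proof.
move=> piE; apply: (@expectE _ _ _ _ #|{: U * V}|.+1) => omega; last first.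
  exact: exec_clip piE _.
by apply: exec_ge0 piE _ => h; apply: reward_ge0.
Qed.

Lemma black_box_star_val U' v :
  kappa * star_val G v #|{: U * V}| 0 U' <=
  E[fun omega => exec (B U' v) omega (reward G)].
Proof.
rewrite -lee_fin -(value_Ex (B_on U' v)) EFinM.
have [_] := B_approx U' v; apply: le_trans.
by rewrite lee_pmul2l ?lte_fin //; apply: star_val_le_star_OPT.
Qed.

Lemma Ex_run N n (pi : policy R U V) omega f h :
  Ex G N (fun omega' => run n pi omega (f omega') h) =
  run n pi omega (fun h' => Ex G N (f^~ h')) h.
Proof.
elim: n h => [//|n IH] h /=; rewrite ExD ExZ Ex_sum; congr (_ + _).
by apply: eq_bigr => e _; rewrite ExZ IH.
Qed.

Lemma greedy_run_ge0 omega vs U' : 0 <= greedy_run G B omega vs U'.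
Proof.
elim: vs U' => //= v vs IH U'; apply: exec_ge0 (B_on _ _) _ => h.
by apply: addr_ge0 => //; apply: reward_ge0.
Qed.

Lemma greedy_run_clip omega vs U' :
  greedy_run G B (clip #|{: U * V}|.+1 omega) vs U' =
  greedy_run G B omega vs U'.
Proof.
elim: vs U' => //= v vs IH U'; apply: exec_clip (B_on _ _) _ => h.
by rewrite IH.
Qed.

Lemma exec_star_agree U' v x y f f' :
  agree (fun e => e.2 == v) (pred1 v) x y -> (forall h, f h = f' h) ->
  exec (B U' v) x f = exec (B U' v) y f'.
Proof.
move=> [xy1 xy2] ff'; apply: (eq_run (P := fun=> True) (B_on U' v)) => //.
move=> h e _ /and4P[]; rewrite inE => /andP[_ ev] _ _ _.
by rewrite /observe xy1 // xy2.
Qed.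

(** Greedy on [vs] reads only the randomness of [vs], hence is independent of an earlier arrival. *)
Lemma greedy_run_agree vs U' x y :
  agree (fun e => e.2 \in vs) [in vs] x y ->
  greedy_run G B x vs U' = greedy_run G B y vs U'.
Proof.
elim: vs U' => //= v vs IH U' [xy1 xy2]; apply: exec_star_agree => [|h].
  by split=> e ev; [apply: xy1 | apply: xy2]; apply/orP; left.
congr (_ + _); apply: IH.
by split=> e ev; [apply: xy1 | apply: xy2]; apply/orP; right.
Qed.

Variable y : U -> V -> R.
Hypothesis y_ge0 : forall u v, 0 <= y u v.
Hypothesis y_le_star_val : forall (U' : {set U}) v,
  \sum_(u in U') weight G u * y u v <= star_val G v #|{: U * V}| 0 U'.

(* A weight w_u earned by greedy on the arrival of v pays for all the later
   terms y u v'. *)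
Lemma greedy_ge vs (U' : {set U}) : uniq vs ->
  (forall u, \sum_(v <- vs) y u v <= 1) ->
  kappa * \sum_(u in U') weight G u * \sum_(v <- vs) y u v <=
  2 * E[fun omega => greedy_run G B omega vs U'].
Proof.
elim: vs U' => [|v vs IH] U' /=.
  move=> _ _; rewrite big1 ?mulr0 => [|u _]; last by rewrite big_nil mulr0.
  by rewrite Ex_cst mulr0.
move=> /andP[v_vs vs_uniq] y_le1.
have y'_le1 u : \sum_(v' <- vs) y u v' <= 1.
  by apply: le_trans (y_le1 u); rewrite big_cons lerDr.
pose Y u := \sum_(v' <- vs) y u v'.
have Y0 u : 0 <= Y u by apply: sumr_ge0.
pose g (A : {set U}) := E[fun omega => greedy_run G B omega vs A].
(* As [v] does not occur in [vs], the later arrivals may use a fresh sample; averaging over it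
   replaces their reward by [g] of the vertices left free. *)
rewrite (Ex_split (fun e => e.2 == v) (pred1 v) (F := fun x x' =>
    exec (B U' v) x (fun h => reward G h +
      greedy_run G B x' vs (U' :\: matched_offline h)%SET))); last first.
  move=> x x' z z' xx' zz'; apply: exec_star_agree xx' _ => h.
  congr (_ + _); apply: greedy_run_agree; case: zz' => zz1 zz2.
  have v'v v' : v' \in vs -> v' != v by move=> ?; apply: contraNneq v_vs => <-.
  by split=> e ev; [apply: zz1 | apply: zz2]; apply: v'v.
rewrite (eq_Ex (F' := fun omega => exec (B U' v) omega (fun h =>
    reward G h + g (U' :\: matched_offline h)%SET))); last first.
  move=> omega; rewrite /exec Ex_run.
  apply: (eq_run (P := fun=> True) (B_on U' v)) => // h _.
  by rewrite ExD Ex_cst.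
(* Of the two copies of the reward at [v], one pays for the terms [y u v] through the black box; the
   other is kept for the vertices matched now. *)
apply: (@le_trans _ _ (E[fun omega => exec (B U' v) omega (reward G)] +
    kappa * \sum_(u in U') weight G u * Y u)).
  under eq_bigr do rewrite big_cons mulrDr.
  rewrite big_split mulrDr lerD2r; apply: le_trans (black_box_star_val U' v).
  by rewrite ler_pM2l.
rewrite addrC -[X in X + _](Ex_cst G #|{: U * V}|.+1) -ExD -ExZ.
apply: le_Ex => omega; set c := kappa * _.
have cst a : exec (B U' v) omega (fun=> a) = a.
  exact: (run_cst (P := fun=> True) (B_on U' v)).
(* Constants are written as averages over the run, so that both sides can be compared history by
   history. *)
rewrite -[X in X + _](cst c) -[X in _ + X]mul1r -[leRHS]addr0.
rewrite -[X in _ <= _ + X](cst 0) [X in X <= _]addrC -!run_linear.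
apply: (le_run (P := legal (star U' v)) (B_on U' v)) => // [h e o|h hE].
  exact: legal_step.
rewrite mul1r addr0 mulrDr mulrDl mul1r -addrA lerD2l.
set M := matched_offline h.
have := IH (U' :\: M)%SET vs_uniq y'_le1; rewrite -/(g _) => leg.
apply: le_trans (lerD (lexx _) leg).
(* The free vertices outside [M] are settled by induction; for [u] in [M] the lost term is at most
   [weight G u], because [kappa * Y u <= 1]. *)
rewrite /c (big_setID M) /= mulrDr lerD2r (legal_reward G hE).
rewrite [leRHS](big_setID U') /= finset.setIC mulr_sumr.
apply: ler_wpDr; first by apply: sumr_ge0 => u _; apply: weight_ge0.
apply: ler_sum => u _; rewrite mulrCA ler_piMr ?weight_ge0 //.
exact: mulr_ile1 (ltW kappa_gt0) (Y0 u) kappa_le1 (y'_le1 u).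
Qed.

End Greedy.

(** * Match probabilities of an offline policy, and the competitive ratio *)

Section Main.
Variables (R : realType) (U V : finType) (G : instance R U V).
Variable pi : policy R U V.
Hypothesis pi_on : policy_on [set: U * V]%SET pi.

Local Notation "'E[' F ]" := (Ex G #|{: U * V}|.+1 F).

(** A probability, since an edge is probed at most once; the expected count makes the value of [pi]
    linear in it. *)
Definition match_prob u v : R :=
  E[fun omega => exec pi omega (fun h => successes R h (u, v))].

Lemma match_prob_ge0 u v : 0 <= match_prob u v.
Proof.
by apply: Ex_ge0 => omega; apply: exec_ge0 pi_on _ => h; apply: ler0n.
Qed.

Lemma match_prob_sum1 u : \sum_v match_prob u v <= 1.
Proof.
rewrite -Ex_sum -[leRHS](Ex_cst G #|{: U * V}|.+1); apply: le_Ex => omega.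
have -> : \sum_v exec pi omega (fun h => successes R h (u, v)) =
    exec pi omega (fun h => \sum_v 1 * successes R h (u, v)).
  by rewrite /exec run_sum; apply: eq_bigr => v _; rewrite mul1r.
have one : exec pi omega (fun=> 1) = 1.
  exact: (run_cst (P := fun=> True) pi_on).
rewrite -[leRHS]one.
apply: (le_run (P := legal [set: U * V]%SET) pi_on) => // [h e o|h hE].
  exact: legal_step.
under eq_bigr do rewrite mul1r.
by rewrite (legal_successes R u hE) lern1 leq_b1.
Qed.

Lemma match_prob_le_star_val (U' : {set U}) v :
  \sum_(u in U') weight G u * match_prob u v <=
  star_val G v #|{: U * V}| 0 U'.
Proof.
apply: le_trans (exec_le_star_val G v U' pi_on).
rewrite le_eqVlt; apply/orP; left; apply/eqP.
under eq_bigr do rewrite -ExZ; rewrite -Ex_sum; apply: eq_Ex => omega.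
by rewrite /exec -run_sum.
Qed.

Lemma value_match_prob :
  value G pi = (\sum_u weight G u * \sum_v match_prob u v)%:E.
Proof.
rewrite (value_Ex G pi_on); congr _%:E.
under [RHS]eq_bigr do rewrite -Ex_sum -ExZ; rewrite -Ex_sum.
apply: eq_Ex => omega.
under eq_bigr => u _.
  rewrite (_ : \sum_v _ =
      exec pi omega (fun h => \sum_v 1 * successes R h (u, v))).
    over.
  by rewrite /exec run_sum; apply: eq_bigr => v _; rewrite mul1r.
rewrite /exec -run_sum; apply: (eq_run (P := fun=> True) pi_on) => // h _.
rewrite rewardE; apply: eq_bigr => u _; congr (_ * _).
by apply: eq_bigr => v _; rewrite mul1r.
Qed.

End Main.

Theorem theorem3 (R : realType) (U V : finType) (G : instance R U V)
    (kappa : R) (B : {set U} -> V -> policy R U V) (order : seq V)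
    (kappa_gt0 : 0 < kappa) (kappa_le1 : kappa <= 1)
    (B_approx : black_box G kappa B)
    (order_uniq : uniq order) (order_all : forall v : V, v \in order) :
  ((kappa / 2)%:E * OPT G <= ALG G B order)%E.
Proof.
rewrite /ALG (@expectE _ _ _ _ #|{: U * V}|.+1) => [|omega|omega]; last first.
- exact: greedy_run_clip B_approx _ _ _.
- exact: greedy_run_ge0 B_approx _ _ _.
set alg := Ex _ _ _.
have k2_gt0 : 0 < kappa / 2 by rewrite divr_gt0.
(* With a finite bound on the right, the supremum defining [OPT] can be treated one policy at a
   time. *)
suff leOPT : (OPT G <= (2 / kappa * alg)%:E)%E.
  apply: le_trans (lee_wpmul2l _ leOPT) _; first by rewrite lee_fin ltW.
  rewrite -EFinM lee_fin mulrA mulrACA [kappa * 2]mulrC -mulrACA.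
  rewrite !divff ?mul1r //.
  by rewrite gt_eqF.
apply: ge_ereal_sup => _ [pi pi_on <-].
rewrite (value_match_prob G pi_on) lee_fin mulrAC ler_pdivlMr // mulrC.
have big_order (F : V -> R) : \sum_(v <- order) F v = \sum_v F v.
  apply: perm_big; apply: uniq_perm; rewrite ?index_enum_uniq // => v.
  by rewrite mem_index_enum order_all.
have le1 u : \sum_(v <- order) match_prob G pi u v <= 1.
  by rewrite big_order; apply: match_prob_sum1.
apply: le_trans (greedy_ge kappa_gt0 kappa_le1 B_approx
  (match_prob_ge0 G pi_on) (match_prob_le_star_val G pi_on) [set: U]%SET
  order_uniq le1).
rewrite le_eqVlt; apply/orP; left; apply/eqP; congr (_ * _).
by apply: eq_big => [u|u _]; rewrite ?inE ?big_order.
Qed.
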